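(* With the notation of the context: 1. The root lattice of $\mathfrak{g}^{(inv)}$, i.e. the $\mathbb{Z}_2$-invariant sublattice $$Q^{(inv)}=\Big\{\sum_{i=-1}^8k_i\alpha_i\in Q(E_{10}):\ k_3\in2\mathbb{Z}\Big\}$$ of the root lattice of $E_{10}$, is isomorphic (as a lattice with bilinear form) to the root lattice $Q(DE_{10})$. 2. The root lattice of the commutant $\mathfrak{g}^{(com)}$ of $\mathfrak{so}(16)$ in $DE_{18}$, i.e. the sublattice $$\{\alpha\in Q(DE_{18}):\ (\alpha|\beta_j)=0,\ j=9,\dots,16\}$$ of the root lattice of $DE_{18}$ orthogonal to the roots of $\mathfrak{so}(16)$, is isomorphic (as a lattice with bilinear form) to the root lattice $Q(DE_{10})$.
   Context: $Q(X)$ denotes the root lattice of the Kac–Moody algebra $X$, with the bilinear form $(\cdot|\cdot)$ given on simple roots by the Cartan matrix. All diagrams are simply laced. $E_{10}$: simple roots $\alpha_{-1},\dots,\alpha_8$; chain $\alpha_{-1}-\alpha_0-\cdots-\alpha_7$ plus a node $\alpha_8$ joined to $\alpha_5$. $DE_{10}$: simple roots $\gamma_{-1},\dots,\gamma_8$; chain $\gamma_{-1}-\gamma_0-\cdots-\gamma_6$ plus a node $\gamma_7$ joined to $\gamma_1$ and a node $\gamma_8$ joined to $\gamma_5$. $DE_{18}$: simple roots $\beta_{-1},\dots,\beta_{16}$; chain $\beta_{-1}-\beta_0-\cdots-\beta_7-\beta_9-\beta_{10}-\cdots-\beta_{15}$ plus a node $\beta_8$ joined to $\beta_1$ and a node $\beta_{16}$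 joined to $\beta_{14}$. The subalgebra $\mathfrak{so}(16)\simeq D_8$ is the one generated by the Chevalley generators of the nodes $\beta_9,\dots,\beta_{16}$. $\mathfrak{g}^{(inv)}\subset E_{10}$ is the subalgebra generated by the Cartan subalgebra and the root spaces of roots $\sum k_i\alpha_i$ with $k_3$ even; $\mathfrak{g}^{(com)}$ is the set of elements commuting with $\mathfrak{so}(16)$. *)

(* Defs.v *)
From HB Require Import structures.
From mathcomp Require Import all_boot all_order all_algebra.

Set Implicit Arguments.
Unset Strict Implicit.
Unset Printing Implicit Defensive.

Import Order.TTheory GRing.Theory Num.Theory.
Local Open Scope ring_scope.

(* The simple roots of all the diagrams are numbered from -1: position i of a
   coefficient vector of size n belongs to the simple root with label i - 1. *)
Definition label (n : nat) (i : 'I_n) : int := i%:Z - 1.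

(* A simply laced diagram is given by the list of its edges, each listed once
   as a pair of labels. *)
Definition adjacent (edges : seq (int * int)) (a b : int) : bool :=
  ((a, b) \in edges) || ((b, a) \in edges).

Definition cartan (n : nat) (edges : seq (int * int)) : 'M[int]_n :=
  \matrix_(i, j) if i == j then 2
                 else if adjacent edges (label i) (label j) then -1 else 0.

(* The row vector k stands for \sum_i k_i alpha_i. *)
Definition root_form (n : nat) (A : 'M[int]_n) (x y : 'rV[int]_n) : int :=
  (x *m A *m y^T) 0 0.

Definition simple_root (n : nat) (a : int) : 'rV[int]_n :=
  \row_(i < n) (label i == a)%:R.

Definition E10_edges : seq (int * int) :=
  [:: (-1, 0); (0, 1); (1, 2); (2, 3); (3, 4); (4, 5); (5, 6); (6, 7);
      (8, 5)].

Definition DE10_edges : seq (int * int) :=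
  [:: (-1, 0); (0, 1); (1, 2); (2, 3); (3, 4); (4, 5); (5, 6);
      (7, 1); (8, 5)].

Definition DE18_edges : seq (int * int) :=
  [:: (-1, 0); (0, 1); (1, 2); (2, 3); (3, 4); (4, 5); (5, 6); (6, 7);
      (7, 9); (9, 10); (10, 11); (11, 12); (12, 13); (13, 14); (14, 15);
      (8, 1); (16, 14)].

Definition Q_E10 : zmodType := 'rV[int]_10.
Definition Q_DE10 : zmodType := 'rV[int]_10.
Definition Q_DE18 : zmodType := 'rV[int]_18.

Definition form_E10 : Q_E10 -> Q_E10 -> int :=
  root_form (cartan 10 E10_edges).
Definition form_DE10 : Q_DE10 -> Q_DE10 -> int :=
  root_form (cartan 10 DE10_edges).
Definition form_DE18 : Q_DE18 -> Q_DE18 -> int :=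
  root_form (cartan 18 DE18_edges).

Definition inv_pred : {pred Q_E10} :=
  fun k : 'rV[int]_10 => [forall i, (label i == 3) ==> (2 %| k 0%R i)%Z].

Definition com_pred : {pred Q_DE18} :=
  fun x => all (fun j : nat => form_DE18 x (simple_root 18 j%:Z) == 0)
               [:: 9; 10; 11; 12; 13; 14; 15; 16]%N.

Fact inv_pred_zmod_closed : zmod_closed inv_pred.
Proof.
split=> [|x y /forallP hx /forallP hy].
  by apply/forallP => i; apply/implyP => _; rewrite mxE dvdz0.
apply/forallP => i; apply/implyP => li.
have /implyP/(_ li) xi := hx i; have /implyP/(_ li) yi := hy i.
by rewrite !mxE rpredB.
Qed.

Fact com_pred_zmod_closed : zmod_closed com_pred.
Proof.
split=> [|x y /allP hx /allP hy].
  by apply/allP => j _; rewrite /form_DE18 /root_form !mul0mx mxE.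
apply/allP => j hj; move: (hx j hj) (hy j hj).
rewrite /form_DE18 /root_form => /eqP ex /eqP ey.
by rewrite !mulmxBl mxE [X in _ + X]mxE ex ey subr0.
Qed.

HB.instance Definition _ :=
  GRing.isZmodClosed.Build Q_E10 inv_pred inv_pred_zmod_closed.
HB.instance Definition _ :=
  GRing.isZmodClosed.Build Q_DE18 com_pred com_pred_zmod_closed.

Record Q_inv := QInv { inv_val :> Q_E10; inv_valP : inv_val \in inv_pred }.
HB.instance Definition _ := [isSub for inv_val].
HB.instance Definition _ := [Choice of Q_inv by <:].
HB.instance Definition _ := [SubChoice_isSubZmodule of Q_inv by <:].

Record Q_com := QCom { com_val :> Q_DE18; com_valP : com_val \in com_pred }.
HB.instance Definition _ := [isSub for com_val].
HB.instance Definition _ := [Choice of Q_com by <:].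
HB.instance Definition _ := [SubChoice_isSubZmodule of Q_com by <:].

Definition form_inv (x y : Q_inv) : int := form_E10 (inv_val x) (inv_val y).
Definition form_com (x y : Q_com) : int := form_DE18 (com_val x) (com_val y).

Definition lattice_isomorphic (L M : zmodType)
    (bL : L -> L -> int) (bM : M -> M -> int) : Prop :=
  exists f : {additive L -> M},
    bijective f /\ forall x y : L, bM (f x) (f y) = bL x y.

(* Main.v *)
Require Import Defs.
From HB Require Import structures.
From mathcomp Require Import all_boot all_order all_algebra.

Set Implicit Arguments.
Unset Strict Implicit.
Unset Printing Implicit Defensive.

Import Order.TTheory GRing.Theory Num.Theory.
Local Open Scope ring_scope.

(* Each sublattice has an explicit basis whose Gram matrix is the Cartan matrix
   of DE_10.  For k_3 even, the basis vectors are the alpha_i with i <> 3, which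
   span A_4 + D_5, and one root with k_3 = 2 that links the two components.  For
   the commutant, D_16 contains D_8 + D_8: one keeps beta_{-1}, ..., beta_6,
   beta_8 and adds the root that closes the fork of the first D_8. *)

(* Matrices given by their entries on natural numbers, so that identities
   between concrete matrices are decided by computation. *)
Definition nat_mx (m n : nat) (F : nat -> nat -> int) : 'M[int]_(m, n) :=
  \matrix_(i, j) F i j.

Definition nat_mul (n : nat) (F G : nat -> nat -> int) (i j : nat) : int :=
  foldr (fun k s => F i k * G k j + s) 0 (iota 0 n).

Definition nat_eqb (m n : nat) (F G : nat -> nat -> int) : bool :=
  all (fun i => all (fun j => F i j == G i j) (iota 0 n)) (iota 0 m).

Lemma nat_mx_mul m n p F G :
  nat_mx m n F *m nat_mx n p G = nat_mx m p (nat_mul n F G).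
Proof.
apply/matrixP => i j; rewrite !mxE /nat_mul.
under eq_bigr do rewrite !mxE.
rewrite -(big_mkord xpredT (fun k => F i k * G k j)) /index_iota subn0.
by elim: (iota 0 n) => [|k s IHs]; rewrite ?big_nil // big_cons IHs.
Qed.

Lemma nat_mx_tr m n F : (nat_mx m n F)^T = nat_mx n m (fun i j => F j i).
Proof. by apply/matrixP => i j; rewrite !mxE. Qed.

Lemma nat_mx_sub m n F G :
  nat_mx m n F - nat_mx m n G = nat_mx m n (fun i j => F i j - G i j).
Proof. by apply/matrixP => i j; rewrite !mxE. Qed.

Lemma nat_mx_scalar n (a : int) :
  a%:M = nat_mx n n (fun i j => if i == j then a else 0).
Proof. by apply/matrixP => i j; rewrite !mxE -val_eqE /=; case: eqP. Qed.

Lemma nat_mx_0 m n : 0 = nat_mx m n (fun _ _ => 0).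
Proof. by apply/matrixP => i j; rewrite !mxE. Qed.

Lemma nat_eqP m n (F G : nat -> nat -> int) (i : 'I_m) (j : 'I_n) :
  nat_eqb m n F G -> F i j = G i j.
Proof.
have memI q (k : 'I_q) : (k : nat) \in iota 0 q by rewrite mem_iota /=.
by move=> /allP /(_ i (memI m i)) /allP /(_ j (memI n j)) /eqP.
Qed.

Lemma nat_mx_eq m n F G : nat_eqb m n F G -> nat_mx m n F = nat_mx m n G.
Proof. by move=> FG; apply/matrixP => i j; rewrite !mxE (nat_eqP _ _ FG). Qed.

Lemma cartanE n edges :
  cartan n edges = nat_mx n n (fun i j => if i == j then 2 else
    if adjacent edges (i%:Z - 1) (j%:Z - 1) then -1 else 0).
Proof. by apply/matrixP => i j; rewrite !mxE. Qed.

(* Row i of the table is a list of pairs (label, coefficient); absent labels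
   have coefficient 0. *)
Definition coef (rows : seq (seq (int * int))) (i j : nat) : int :=
  foldr (fun p s => if p.1 == j%:Z - 1 then p.2 else s) 0 (nth [::] rows i).

Definition table (m n : nat) (rows : seq (seq (int * int))) :=
  nat_mx m n (coef rows).

Ltac mx_compute :=
  rewrite /table ?cartanE ?nat_mx_tr ?nat_mx_mul ?nat_mx_scalar ?nat_mx_sub;
  rewrite ?nat_mx_mul ?nat_mx_0; apply: nat_mx_eq; vm_cast_no_check (erefl true).

Lemma root_form_mulmx n m (A : 'M[int]_m) (G : 'M[int]_(n, m)) x y :
  root_form A (x *m G) (y *m G) = root_form (G *m A *m G^T) x y.
Proof. by rewrite /root_form trmx_mul !mulmxA. Qed.

(* A and A' are Gram matrices.  The rows of G are a basis of L with Gram matrix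
   A', and H / 2 is the matrix of the coordinates with respect to this basis. *)
Lemma lattice_isomorphic_of_basis n m (A : 'M[int]_m) (A' : 'M[int]_n)
    (G : 'M[int]_(n, m)) (H : 'M[int]_(m, n)) (L : zmodType)
    (v : L -> 'rV[int]_m) (s : 'rV[int]_n -> L) :
  {morph v : x y / x - y} -> injective v ->
  G *m A *m G^T = A' -> G *m H = 2%:M ->
  (forall y, v (s y) = y *m G) ->
  (forall x, v x *m H *m G = 2 *: v x) ->
  (forall x i, (2 %| (v x *m H) 0%R i)%Z) ->
  lattice_isomorphic (fun x y => root_form A (v x) (v y)) (root_form A').
Proof.
have double_inj p q := @scalemx_inj int p q 2 isT.
move=> vB v_inj GAG GH vs HG even_H.
(* [even_H] makes this division exact; identities for [f] are then checked after doubling. *)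
pose f (x : L) : 'rV[int]_n := map_mx (fun a => (a %/ 2)%Z) (v x *m H).
have f2 x : 2 *: f x = v x *m H.
  by apply/rowP => i; rewrite mxE [f x _ _]mxE mulrC divzK.
have fG x : f x *m G = v x.
  by apply: double_inj; rewrite /= scalemxAl f2 HG.
have fB : zmod_morphism f.
  by move=> x y; apply: double_inj; rewrite /= scalerBr !f2 vB mulmxBl.
pose fa : {additive L -> 'rV[int]_n} :=
  HB.pack f (GRing.isZmodMorphism.Build L 'rV[int]_n f fB).
exists fa; split=> [|x y] /=; last by rewrite -GAG -root_form_mulmx !fG.
exists s => [x|y] /=; first by apply: v_inj; rewrite vs fG.
by apply: double_inj; rewrite /= f2 vs -mulmxA GH mul_mx_scalar.
Qed.

(** Rows are the images of gamma_{-1}, ..., gamma_8 in order. The fourth is the highest root of the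
    D_6 on alpha_2, ..., alpha_6, alpha_8; it has product -1 with alpha_1 and alpha_7, and 0 with
    the other rows. *)
Definition inv_basis : seq (seq (int * int)) :=
  [:: [:: (-1, 1)]; [:: (0, 1)]; [:: (1, 1)];
      [:: (2, 1); (3, 2); (4, 2); (5, 2); (6, 1); (8, 1)];
      [:: (7, 1)]; [:: (6, 1)]; [:: (5, 1)]; [:: (4, 1)];
      [:: (2, 1)]; [:: (8, 1)]].

(** The row of alpha_3 comes from solving the fourth row of [inv_basis] for 2 alpha_3. *)
Definition inv_coord2 : seq (seq (int * int)) :=
  [:: [:: (-1, 2)]; [:: (0, 2)]; [:: (1, 2)]; [:: (7, 2)];
      [:: (2, 1); (4, -1); (5, -2); (6, -2); (7, -1); (8, -1)];
      [:: (6, 2)]; [:: (5, 2)]; [:: (4, 2)]; [:: (3, 2)]; [:: (8, 2)]].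

Lemma inv_basis_pred (y : 'rV[int]_10) :
  (y *m table 10 10 inv_basis : Q_E10) \in inv_pred.
Proof.
apply/forallP => i; apply/implyP => li; rewrite mxE.
apply: rpred_sum => k _; rewrite mxE; apply: dvdz_mull.
have chk : nat_eqb 10 10
    (fun k i => if i%:Z - 1 == 3 then (coef inv_basis k i %% 2)%Z else 0)
    (fun _ _ => 0) by vm_cast_no_check (erefl true).
have := nat_eqP k i chk; rewrite /label in li; rewrite li.
by move/dvdz_mod0P.
Qed.

(** Odd entries of [inv_coord2] occur only in the row of alpha_3, which gets multiplied by the even
    k_3. *)
Lemma inv_coord2_even (x : Q_inv) i :
  (2 %| (inv_val x *m table 10 10 inv_coord2 : 'rV_10) 0%R i)%Z.
Proof.
rewrite mxE; apply: rpred_sum => k _; rewrite mxE.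
case: (boolP (label k == 3)) => lk.
  by apply: dvdz_mulr; move/forallP/(_ k)/implyP: (inv_valP x); apply.
apply: dvdz_mull.
have chk : nat_eqb 10 10
    (fun k i => if k%:Z - 1 == 3 then 0 else (coef inv_coord2 k i %% 2)%Z)
    (fun _ _ => 0) by vm_cast_no_check (erefl true).
have := nat_eqP k i chk; rewrite /label in lk; rewrite (negPf lk).
by move/dvdz_mod0P.
Qed.

Lemma Q_inv_isomorphic : lattice_isomorphic form_inv form_DE10.
Proof.
apply: (lattice_isomorphic_of_basis (A := cartan 10 E10_edges)
  (G := table 10 10 inv_basis) (H := table 10 10 inv_coord2)
  (v := inv_val) (s := fun y => QInv (inv_basis_pred y))) => //.
- exact: val_inj.
- by mx_compute.
- by mx_compute.
- move=> x; rewrite -mulmxA.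
  have -> : table 10 10 inv_coord2 *m table 10 10 inv_basis = 2%:M.
    by mx_compute.
  by rewrite mul_mx_scalar.
exact: inv_coord2_even.
Qed.

(* Write beta_8, beta_1, ..., beta_7, beta_9, ..., beta_15 as e_i - e_(i+1) for
   i = 1, ..., 15 and beta_16 as e_15 + e_16.  Then beta_6 = e_7 - e_8, and the
   last row is e_7 + e_8. *)
Definition com_basis : seq (seq (int * int)) :=
  [:: [:: (-1, 1)]; [:: (0, 1)]; [:: (1, 1)]; [:: (2, 1)]; [:: (3, 1)];
      [:: (4, 1)]; [:: (5, 1)]; [:: (6, 1)]; [:: (8, 1)];
      [:: (6, 1); (7, 2); (9, 2); (10, 2); (11, 2); (12, 2); (13, 2); (14, 2);
          (15, 1); (16, 1)]].

(** In [com_basis], beta_15 occurs only in the last row, with coefficient 1. So the last coordinate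
    is x_15, and that of beta_6 is x_6 - x_15. *)
Definition com_coord2 : seq (seq (int * int)) :=
  [:: [:: (-1, 2)]; [:: (0, 2)]; [:: (1, 2)]; [:: (2, 2)]; [:: (3, 2)];
      [:: (4, 2)]; [:: (5, 2)]; [:: (6, 2)]; [::]; [:: (7, 2)];
      [::]; [::]; [::]; [::]; [::]; [::]; [:: (6, -2); (8, 2)]; [::]].

Definition so16_roots : seq (seq (int * int)) :=
  [seq [:: (j%:Z, 1)] | j <- iota 9 8].

(* In terms of x_7, ..., x_16 and a_j = (x|beta_j), column l of this table is
   2 x_l - 4 x_15 (for l = 7, 9, ..., 14) or 2 x_16 - 2 x_15 (for l = 16)
   written as a combination of a_9, ..., a_16. *)
Definition com_relations : seq (seq (int * int)) :=
  [:: [:: (7, -2)];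
      [:: (7, -4); (9, -2)];
      [:: (7, -6); (9, -4); (10, -2)];
      [:: (7, -8); (9, -6); (10, -4); (11, -2)];
      [:: (7, -10); (9, -8); (10, -6); (11, -4); (12, -2)];
      [:: (7, -12); (9, -10); (10, -8); (11, -6); (12, -4); (13, -2)];
      [:: (7, -8); (9, -7); (10, -6); (11, -5); (12, -4); (13, -3); (14, -2);
          (16, -1)];
      [:: (7, -6); (9, -5); (10, -4); (11, -3); (12, -2); (13, -1); (16, 1)]].

Lemma com_predP (x : Q_DE18) :
  reflect (x *m cartan 18 DE18_edges *m (table 8 18 so16_roots)^T = 0)
          (x \in com_pred).
Proof.
have row_simple (i : 'I_8) :
    row i (table 8 18 so16_roots) = simple_root 18 (9 + i)%N%:Z.
  apply/rowP => j; rewrite !mxE /coef (nth_map 0%N) ?size_iota // nth_iota //=.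
  by rewrite /label eq_sym; case: eqP.
have entry (i : 'I_8) :
    (x *m cartan 18 DE18_edges *m (table 8 18 so16_roots)^T) 0 i =
    form_DE18 x (simple_root 18 (9 + i)%N%:Z).
  rewrite /form_DE18 /root_form -row_simple tr_row colE mulmxA -colE.
  by rewrite [RHS]mxE.
apply: (iffP allP) => [hx | /rowP hx j].
  apply/rowP => i; rewrite entry [RHS]mxE; apply/eqP/hx.
  by rewrite -[in X in _ \in X]/(iota 9 8) mem_iota leq_addr ltn_add2l ltn_ord.
rewrite -[in X in _ \in X]/(iota 9 8) mem_iota => /andP[le9j ltj].
have lt8 : (j - 9 < 8)%N by rewrite ltn_subLR.
by have := hx (Ordinal lt8); rewrite entry /= subnKC // mxE => /eqP.
Qed.

Lemma com_basis_pred (y : 'rV[int]_10) :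
  (y *m table 10 18 com_basis : Q_DE18) \in com_pred.
Proof.
apply/com_predP; rewrite -!mulmxA [table 10 18 _ *m _](_ : _ = 0) ?mulmx0 //.
by mx_compute.
Qed.

Lemma Q_com_isomorphic : lattice_isomorphic form_com form_DE10.
Proof.
apply: (lattice_isomorphic_of_basis (A := cartan 18 DE18_edges)
  (G := table 10 18 com_basis) (H := table 18 10 com_coord2)
  (v := com_val) (s := fun y => QCom (com_basis_pred y))) => //.
- exact: val_inj.
- by mx_compute.
- by mx_compute.
- move=> x; have /com_predP xR := com_valP x.
  (* The defect of [H / 2] as a right inverse factors through the products with the roots of so(16),
     so it vanishes on the commutant. *)
  have rel : 2%:M - table 18 10 com_coord2 *m table 10 18 com_basis =
      cartan 18 DE18_edges *m (table 8 18 so16_roots)^T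
      *m table 8 18 com_relations by mx_compute.
  apply/esym/eqP; rewrite -subr_eq0 -mul_mx_scalar -mulmxA -mulmxBr rel.
  by rewrite !mulmxA xR mul0mx.
move=> x i; rewrite mxE; apply: rpred_sum => k _; rewrite mxE.
apply: dvdz_mull; have chk : nat_eqb 18 10
    (fun k i => (coef com_coord2 k i %% 2)%Z) (fun _ _ => 0).
  by vm_cast_no_check (erefl true).
by have /dvdz_mod0P := nat_eqP k i chk.
Qed.

Theorem mainTheorem6 :
  lattice_isomorphic form_inv form_DE10 /\
  lattice_isomorphic form_com form_DE10.
Proof. exact: conj Q_inv_isomorphic Q_com_isomorphic. Qed.
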